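(* For every positive integer $j$, there exists an arrangement $L$ of $n = 18j + 7$ pseudolines in the real projective plane $\mathbb{P}^2$, not all passing through a single point, such that no pseudoline of $L$ is incident to more than $8j + 2$ vertices of $L$.
   Context: An arrangement of pseudolines is a finite set of simple closed curves in the real projective plane $\mathbb{P}^2$, any two (distinct) of which meet at exactly one point, and at that point they cross. A vertex of an arrangement $L$ is a point of $\mathbb{P}^2$ incident to (lying on) at least $2$ pseudolines of $L$. The number of pseudolines in an arrangement is the number of distinct curves in it. *)

(* Defs.v *)
From HB Require Import structures.
From mathcomp Require Import all_boot all_order all_algebra generic_quotient.
From mathcomp Require Import all_classical all_reals.
From mathcomp Require Import topology normedtype.

Set Implicit Arguments.
Unset Strict Implicit.
Unset Printing Implicit Defensive.

Import Order.TTheory GRing.Theory Num.Theory.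
Import numFieldNormedType.Exports.

Local Open Scope classical_set_scope.
Local Open Scope quotient_scope.
Local Open Scope ring_scope.

(** The real projective plane: the quotient of [R^3 \ {0}], with its subspace
    topology, by proportionality, carrying the quotient topology. *)
Notation nonzero_vec R := (set_type [set v : 'rV[R]_3 | v != 0]).

(* [u] and [v] span the same line through the origin. *)
Definition same_line (R : realType) (u v : nonzero_vec R) : bool :=
  ((set_val u : 'rV[R]_3) == (set_val v : 'rV[R]_3))%MS.

Lemma same_line_refl (R : realType) : reflexive (@same_line R).
Proof. by move=> u; rewrite /same_line submx_refl. Qed.

Lemma same_line_sym (R : realType) : symmetric (@same_line R).
Proof. by move=> u v; rewrite /same_line andbC. Qed.

Lemma same_line_trans (R : realType) : transitive (@same_line R).
Proof.
move=> v u w /andP[uv vu] /andP[vw wv].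
by rewrite /same_line (submx_trans uv vw) (submx_trans wv vu).
Qed.

Canonical same_line_equiv (R : realType) :=
  EquivRel (@same_line R) (@same_line_refl R) (@same_line_sym R)
    (@same_line_trans R).

Definition RP2 (R : realType) : Type :=
  quotient_topology {eq_quot @same_line R}.

HB.instance Definition _ (R : realType) := Topological.on (RP2 R).
HB.instance Definition _ (R : realType) := Quotient.on (RP2 R).

(* The image of a circle, seen as [0, 1] with its endpoints identified. *)
Definition simple_closed_curve (R : realType) (T : topologicalType)
    (C : set T) : Prop :=
  exists c : R -> T,
    [/\ {within `[0, 1], continuous c}, c 0 = c 1,
        {in `[0, 1[ &, injective c} & C = c @` `[0, 1]].

Definition homeomorphism_between (T T' : topologicalType)
    (U : set T) (V : set T') (f : T -> T') : Prop :=
  exists g : T' -> T,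
    [/\ {homo f : x / U x >-> V x}, {homo g : y / V y >-> U y},
        {in U, cancel f g} /\ {in V, cancel g f},
        {within U, continuous f} & {within V, continuous g}].

(* Two curves cross at a common point [p] when, near [p], the pair of curves
   looks topologically like the two coordinate axes of the real plane near
   the origin. *)
Definition cross_at (R : realType) (T : topologicalType) (C D : set T)
    (p : T) : Prop :=
  exists (U : set T) (V : set (R * R)) (f : T -> R * R),
    [/\ open U /\ U p, open V, homeomorphism_between U V f, f p = (0, 0) &
        forall q, U q -> (C q <-> (f q).2 = 0) /\ (D q <-> (f q).1 = 0)].

Definition pseudoline_arrangement (R : realType) (L : set (set (RP2 R))) :
    Prop :=
  [/\ finite_set L,
      forall C, L C -> simple_closed_curve R C &
      forall C D, L C -> L D -> C <> D ->
        exists p, C `&` D = [set p] /\ cross_at R C D p].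

Definition vertices (R : realType) (L : set (set (RP2 R))) : set (RP2 R) :=
  [set p | exists C D, [/\ L C, L D, C <> D, C p & D p]].

(* Main.v *)
(* Remove a point from the projective plane: what is left is a Moebius strip,
   with coordinates (s, z), s in [-M, M], where (-M, z) is glued to (M, -z).
   A pseudoline avoiding the removed point (the pole) is the graph of a
   continuous g with g M = - g (- M); a line through the pole is a fiber
   s = constant.

   Let M = 3 j + 1 and take, around the strip, 2 M equally spaced fibers, the
   line z = 0, and two classes of 2 M "sides", z = +-(M - |s - c|) and
   z = +-3 (M - |s - c|), where c runs over every other fiber (as a polygon has
   its sides, rotated around its center).  Two sides of the same class cross on
   a fiber, halfway between their centers.  Sides of different classes, at
   distances u and v from their centers, cross where |u| = 3 |v| - 2 M
   or |u| + 3 |v| = 4 M; measuring in steps between consecutive fibers, all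
   these crossings happen at integers (on a fiber) or at half-integers, and a
   given side has only 2 j of the latter kind, hence 2 M + 2 j = 8 j + 2
   vertices in all. *)

Require Import Defs.
From HB Require Import structures.
From mathcomp Require Import all_boot all_order all_algebra generic_quotient.
From mathcomp Require Import all_classical all_reals.
From mathcomp Require Import topology normedtype.
From mathcomp Require Import ring lra zify.

Set Implicit Arguments.
Unset Strict Implicit.
Unset Printing Implicit Defensive.

Import Order.TTheory GRing.Theory Num.Theory.
Import numFieldNormedType.Exports.

Local Open Scope classical_set_scope.
Local Open Scope quotient_scope.
Local Open Scope card_scope.
Local Open Scope ring_scope.

(** * Points and continuity in the projective plane *)

Section ProjectivePoints.
Context {R : realType}.

Definition proj (u : nonzero_vec R) : RP2 R := \pi_(RP2 R) u.

Definition mkvec (v : 'rV[R]_3) (v0 : v != 0) : nonzero_vec R :=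
  exist _ v (mem_set v0).

Lemma unit_vec_neq0 : delta_mx 0 0 != 0 :> 'rV[R]_3.
Proof. by apply/eqP => /matrixP/(_ 0 0)/eqP; rewrite !mxE/= oner_eq0. Qed.

(** Total, with an arbitrary value at 0, so that curves can be given by plain vector-valued
    functions whose nonvanishing is proved apart. *)
Definition pt (v : 'rV[R]_3) : RP2 R :=
  if pselect (v != 0) is left v0 then proj (mkvec v0)
  else proj (mkvec unit_vec_neq0).

Lemma ptE (v : 'rV[R]_3) (v0 : v != 0) : pt v = proj (mkvec v0).
Proof.
by rewrite /pt; case: pselect => // v0'; rewrite (Prop_irrelevance v0' v0).
Qed.

Lemma pt_eq (u v : 'rV[R]_3) : u != 0 -> v != 0 ->
  pt u = pt v <-> exists a, u = a *: v.
Proof.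
move=> u0 v0; rewrite !ptE /proj; split.
  move/eqmodP => /andP[/sub_rVP [a uv] _]; by exists a.
move=> [a uv]; apply/eqmodP; change (u == v)%MS.
have a0 : a != 0 by apply: contra_neq u0 => a0; rewrite uv a0 scale0r.
apply/andP; split; first by rewrite uv scalemx_sub.
by rewrite -[v](scalerK a0) -uv scalemx_sub.
Qed.

(** An arbitrary choice of representative; continuity is regained after composition with
    scale-invariant functions. *)
Definition hcoord (p : RP2 R) : 'rV[R]_3 := set_val (repr p).

Lemma hcoord_neq0 p : hcoord p != 0.
Proof. exact: set_mem (proj2_sig (repr p)). Qed.

Lemma hcoordK p : pt (hcoord p) = p.
Proof.
rewrite (ptE (hcoord_neq0 p)) /proj -[RHS]reprK; congr (\pi _).
exact: val_inj.
Qed.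

Lemma pt_continuous (T : topologicalType) (f : T -> 'rV[R]_3) :
  continuous f -> (forall t, f t != 0) -> continuous (pt \o f).
Proof.
move=> cf f0.
have -> : pt \o f = proj \o (fun t => mkvec (f0 t)).
  by apply/funext => t /=; rewrite (ptE (f0 t)).
move=> t; apply: continuous_comp; last exact: pi_continuous.
apply: (@continuous_comp_initial _ T _ (set_val : nonzero_vec R -> _)).
exact: cf.
Qed.


Lemma hcoord_pt v : v != 0 -> exists2 a, a != 0 & hcoord (pt v) = a *: v.
Proof.
move=> v0; have [a aE] := (pt_eq (hcoord_neq0 (pt v)) v0).1 (hcoordK _).
exists a => //; apply: contra_neq (hcoord_neq0 (pt v)) => a0.
by rewrite aE a0 scale0r.
Qed.

Lemma hcoord_proj (u : nonzero_vec R) :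
  exists2 a, a != 0 & hcoord (\pi_(RP2 R) u) = a *: set_val u.
Proof.
have u0 : set_val u != 0 by exact: set_mem (proj2_sig u).
have [a a0] := hcoord_pt u0; exists a => //.
suff -> : \pi_(RP2 R) u = pt (set_val u) by [].
by rewrite (ptE u0); congr (\pi_(_) _); exact: val_inj.
Qed.

(** In the quotient topology only the preimage among nonzero vectors matters; by scale invariance it
    is the trace of [P], whatever representatives [repr] picks. *)
Lemma open_RP2 (P : set 'rV[R]_3) :
  (forall a v, a != 0 -> P (a *: v) -> P v) -> open P -> open (hcoord @^-1` P).
Proof.
move=> PZ oP; rewrite /open /= /quotient_open.
have -> : \pi_(RP2 R) @^-1` (hcoord @^-1` P) = (set_val : nonzero_vec R -> _) @^-1` P.
  apply/seteqP; split => u /=; have [a a0 ->] := hcoord_proj u.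
  - exact: PZ.
  - by move=> Pu; apply: (PZ a^-1); rewrite ?invr_eq0// scalerK.
by exists P.
Qed.

(** The part in [P] of the preimage under [F] of an open set is again open and scale-invariant, so
    [open_RP2] applies to it. *)
Lemma hcoord_continuous (Y : topologicalType) (P : set 'rV[R]_3)
    (F : 'rV[R]_3 -> Y) :
  (forall a v, a != 0 -> P (a *: v) -> P v) ->
  (forall a v, a != 0 -> P v -> F (a *: v) = F v) ->
  open P -> {in P, continuous F} -> {within hcoord @^-1` P, continuous (F \o hcoord)}.
Proof.
move=> PZ FZ oP cF.
apply: continuous_in_subspaceT.
apply/continuous_inP; first exact: open_RP2.
move=> X oX; change (open (hcoord @^-1` (P `&` F @^-1` X))).
apply: open_RP2.
  move=> a v a0 [Pv Xv]; split; first exact: PZ Pv.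
  by have := Xv; rewrite /= FZ//; exact: PZ Pv.
exact: (continuous_inP F oP).1 cF X oX.
Qed.

End ProjectivePoints.

(** * Charts of the projective plane, and crossings read in a chart *)

Section Charts.
Context {R : realType}.

Definition vec3 (x y z : R) : 'rV[R]_3 := \row_i [:: x; y; z]`_i.

Lemma vec3E x y z :
  (vec3 x y z 0 0 = x) * (vec3 x y z 0 1 = y) * (vec3 x y z 0 ord_max = z).
Proof. by rewrite !mxE. Qed.

Lemma row3P (u v : 'rV[R]_3) :
  [/\ u 0 0 = v 0 0, u 0 1 = v 0 1 & u 0 ord_max = v 0 ord_max] <-> u = v.
Proof.
split=> [[e0 e1 e2]|->//]; apply/rowP => -[[|[|[|//]]] i3].
- by rewrite (_ : Ordinal _ = 0)//; exact: val_inj.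
- by rewrite (_ : Ordinal _ = 1)//; exact: val_inj.
- by rewrite (_ : Ordinal _ = ord_max)//; exact: val_inj.
Qed.

Lemma vec3_continuous (T : topologicalType) (f g h : T -> R) :
  continuous f -> continuous g -> continuous h ->
  continuous (fun t => vec3 (f t) (g t) (h t)).
Proof.
move=> cf cg ch t A [P Pt PA].
have {}Pt j : nbhs t [set t' | P 0 j (vec3 (f t') (g t') (h t') 0 j)].
  have := Pt 0 j; rewrite !mxE; case: j => [[|[|[|//]]] j3] /= Pt0;
    under eq_set do rewrite mxE/=.
  - exact: cf.
  - exact: cg.
  - exact: ch.
apply: (filterS _ (filter_forall _ Pt)) => t' Pt'.
by apply: PA => i j; rewrite ord1; exact: Pt'.
Qed.

Lemma continuous_pair (T : topologicalType) (f g : T -> R) :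
  continuous f -> continuous g -> continuous (fun t => (f t, g t)).
Proof. by move=> cf cg t; exact: (cvg_pair (cf t) (cg t)). Qed.

(** [F] reads coordinates on the cone [P], and [G] is a section of it over [D]. Outside [D] too, [G]
    is nonzero and continuous, so that [pt \o G] is continuous on the whole plane. *)
Definition proj_chart (P : set 'rV[R]_3) (F : 'rV[R]_3 -> R * R)
    (G : R * R -> 'rV[R]_3) (D : set (R * R)) :=
  [/\ open P,
      forall a v, a != 0 -> P v -> P (a *: v) /\ F (a *: v) = F v,
      forall v, P v -> D (F v) /\ exists a, v = a *: G (F v),
      (forall w, G w != 0) /\ forall w, D w -> P (G w) /\ F (G w) = w &
      {in P, continuous F} /\ continuous G].

(** Reduces a crossing to a planar problem: [phi] straightens the two curves, read in the chart,
    onto the axes; composed with the chart it is the local model that [cross_at] demands. *)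
Lemma cross_in_chart P F G D (U W : set (R * R)) (phi psi : R * R -> R * R)
    (C1 C2 : set (RP2 R)) (w0 : R * R) :
  proj_chart P F G D -> U `<=` D -> open U -> open W ->
  continuous phi -> continuous psi ->
  (forall w, U w -> W (phi w) /\ psi (phi w) = w) ->
  (forall w, W w -> U (psi w) /\ phi (psi w) = w) ->
  (forall w, U w -> (C1 (pt (G w)) <-> (phi w).2 = 0) /\
                    (C2 (pt (G w)) <-> (phi w).1 = 0)) ->
  U w0 -> phi w0 = (0, 0) ->
  cross_at R C1 C2 (pt (G w0)).
Proof.
move=> [oP PF DG [G0 GD] [cF cG]] UD oU oW cphi cpsi phiK psiK phiC Uw0 phi0.
(* Being a cone, [Q] descends to an open neighborhood of the crossing point. *)
pose Q := P `&` F @^-1` U.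
have oQ : open Q by exact: (continuous_inP F oP).1 cF U oU.
have FQ a v : a != 0 -> Q (a *: v) -> Q v.
  move=> a0 [Pav Uav]; have a0' : a^-1 != 0 by rewrite invr_eq0.
  by have [] := PF _ _ a0' Pav; rewrite scalerK// => Pv Fv; split; rewrite /= ?Fv.
have QG w : U w -> Q (hcoord (pt (G w))) /\ F (hcoord (pt (G w))) = w.
  move=> Uw; have [a a0 ->] := hcoord_pt (G0 w).
  have [Pw Fw] := GD w (UD w Uw); have [PaG FaG] := PF a _ a0 Pw.
  by rewrite /Q/= FaG Fw.
have ptGF q : Q (hcoord q) -> pt (G (F (hcoord q))) = q.
  move=> [Pq _]; rewrite -[RHS]hcoordK; apply/esym/pt_eq => //.
    exact: hcoord_neq0.
  by have [] := DG _ Pq.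
exists (hcoord @^-1` Q), W, (phi \o F \o hcoord); split => //.
- split; first exact: open_RP2.
  by have [] := QG _ Uw0.
- exists (fun w => pt (G (psi w))); split.
  + by move=> q [_ Uq]; have [] := phiK _ Uq.
  + by move=> w Ww; have [Uw _] := psiK _ Ww; have [] := QG _ Uw.
  + split=> [q /set_mem Qq|w /set_mem Ww] /=.
      by rewrite (phiK _ Qq.2).2 ptGF.
    by have [Uw phiw] := psiK _ Ww; rewrite (QG _ Uw).2.
  + apply: (@hcoord_continuous _ _ Q (phi \o F)) => //.
      by move=> a v a0 [Pv Uv] /=; rewrite (PF _ _ a0 Pv).2.
    move=> v /set_mem [/mem_set Pv Uv].
    by apply: (@continuous_comp _ _ _ F phi v); [exact: cF|exact: cphi].
  + apply: continuous_subspaceT.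
    apply: (@pt_continuous _ _ (G \o psi)) => [w|w]; last exact: G0.
    by apply: (@continuous_comp _ _ _ psi G); [exact: cpsi|exact: cG].
- by rewrite /= (QG _ Uw0).2.
- by move=> q Qq; have := phiC _ Qq.2; rewrite ptGF.
Qed.

(** Swapping the coordinates of the plane exchanges the two axes. *)
Lemma cross_at_sym (C1 C2 : set (RP2 R)) p :
  cross_at R C1 C2 p -> cross_at R C2 C1 p.
Proof.
move=> [U [V [f [[oU Up] oV [g [hf hg [gK fK] cf cg]] fp CE]]]].
pose sw (w : R * R) := (w.2, w.1).
have csw : continuous sw.
  by apply: continuous_pair => w; [exact: cvg_snd|exact: cvg_fst].
have oV' : open (sw @^-1` V) by move/continuousP : csw; exact.
exists U, (sw @^-1` V), (sw \o f); split => //.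
- exists (g \o sw); split.
  + by move=> x Ux /=; rewrite /sw /= -surjective_pairing; exact: hf.
  + by move=> y Vy; exact: hg.
  + split=> [x Ux|y Vy] /=.
      by rewrite /sw /= -surjective_pairing; exact: gK.
    have -> : f (g (sw y)) = sw y by apply: fK; move: Vy; rewrite !inE.
    by case: y {Vy}.
  + move: cf; rewrite !continuous_open_subspace// => cf q Uq.
    by apply: (@continuous_comp _ _ _ f sw); [exact: cf|exact: csw].
  + move: cg; rewrite !continuous_open_subspace// => cg w /set_mem Vw.
    apply: (@continuous_comp _ _ _ sw g); first exact: csw.
    by apply: cg; rewrite inE.
- by rewrite /= fp.
- by move=> q /CE [? ?].
Qed.

End Charts.

(** * Coordinates on the Moebius strip and around the pole *)

Section MoebiusCoordinates.
Context {R : realType} (H : R) (H0 : 0 < H).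

(** The pair (s, H - |s|) runs over the upper half of the square |x| + |y| = H, one vector per
    direction, except that its ends s = -H and s = H are opposite: this is the gluing of the
    strip. *)
Definition mob (w : R * R) : 'rV[R]_3 := vec3 w.1 (H - `|w.1|) w.2.

(** Solving X = s / (H - |s|) gives s = H X / (1 + |X|) and H - |s| = H / (1 + |X|). *)
Definition mob_inv (v : 'rV[R]_3) : R * R :=
  let X := v 0 0 / v 0 1 in
  (H * X / (1 + `|X|), H * (v 0 ord_max / v 0 1) / (1 + `|X|)).

Lemma coord_neq0_open (j : 'I_3) : open [set v : 'rV[R]_3 | v 0 j != 0].
Proof.
have -> : [set v : 'rV[R]_3 | v 0 j != 0] = (fun v => v 0 j) @^-1` [set~ 0].
  by apply/seteqP; split => v /= /eqP.
apply: open_comp => [v _|]; first exact: coord_continuous.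
exact/closed_openC/closed_eq.
Qed.

Lemma mob_neq0 w : mob w != 0.
Proof.
apply/eqP => /row3P[]; rewrite !vec3E !mxE => -> /eqP.
by rewrite normr0 subr0 gt_eqF.
Qed.

Lemma ratio_scale (a : R) (v : 'rV[R]_3) i j : a != 0 ->
  (a *: v) 0 i / (a *: v) 0 j = v 0 i / v 0 j.
Proof. by move=> a0; rewrite !mxE -mulf_div divff// mul1r. Qed.

Lemma ratio_continuous (i j : 'I_3) (v : 'rV[R]_3) : v 0 j != 0 ->
  {for v, continuous (fun v : 'rV[R]_3 => v 0 i / v 0 j)}.
Proof.
move=> vj; apply: continuousM; first exact: coord_continuous.
by apply: continuousV => //; exact: coord_continuous.
Qed.

Lemma normDS_gt0 (x : R) : 0 < 1 + `|x|.
Proof. by rewrite ltr_pwDl. Qed.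

(** The middle coordinate vanishes on the seam |s| = H, so this chart serves crossings away from the
    seam. *)
Lemma mob_chart :
  proj_chart [set v | v 0 1 != 0] mob_inv mob [set w | `|w.1| < H].
Proof.
split.
- exact: coord_neq0_open.
- move=> a v a0 /= v1; split; first by rewrite mxE mulf_neq0.
  by rewrite /mob_inv !ratio_scale.
- move=> v /= v1; rewrite /mob_inv /=.
  set X := v 0 0 / v 0 1; have X1 := normDS_gt0 X; have X1' := lt0r_neq0 X1.
  have nX : `|H * X / (1 + `|X|)| = H * `|X| / (1 + `|X|).
    move: (X) X1 => Y Y1.
    by rewrite normrM normfV (gtr0_norm Y1) normrM (gtr0_norm H0).
  split; first by rewrite nX ltr_pdivrMr// ltr_pM2l// ltrDr.
  have H0' := lt0r_neq0 H0.
  exists (v 0 1 * (1 + `|X|) / H); rewrite /mob /= nX.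
  apply/row3P; split; rewrite [RHS]mxE vec3E.
  + by rewrite /X; field; rewrite H0' v1 X1'.
  + by field; rewrite H0' X1'.
  + by field; rewrite H0' v1 X1'.
- split; first exact: mob_neq0.
  move=> [s z] /= sH; rewrite /mob_inv /mob /= !vec3E.
  have d0 : 0 < H - `|s| by rewrite subr_gt0.
  have d0' := lt0r_neq0 d0; have H0' := lt0r_neq0 H0.
  have e : 1 + `|s / (H - `|s|)| = H / (H - `|s|).
    by rewrite normrM normfV (gtr0_norm d0); field.
  split => //; rewrite e; congr (_, _); field; by rewrite H0' d0'.
- split.
  + move=> v /set_mem /= v1.
    have cX := @ratio_continuous 0 1 v v1.
    have cn : {for v, continuous (fun v : 'rV[R]_3 => (1 + `|v 0 0 / v 0 1|)^-1)}.
      have c1 : {for v, continuous (fun _ : 'rV[R]_3 => 1 : R)}.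
        exact: cst_continuous.
      have ca : {for v, continuous (fun v : 'rV[R]_3 => `|v 0 0 / v 0 1|)}.
        by apply: continuous_comp cX _; exact: norm_continuous.
      apply: continuousV; first exact/lt0r_neq0/normDS_gt0.
      exact: continuousD c1 ca.
    have cH : {for v, continuous (fun _ : 'rV[R]_3 => H)} by exact: cst_continuous.
    have cXH := continuousM (continuousM cH cX) cn.
    have cZH := continuousM (continuousM cH (@ratio_continuous ord_max 1 v v1)) cn.
    exact: (cvg_pair cXH cZH).
  + apply: vec3_continuous => w; first exact: cvg_fst.
      have cH : {for w, continuous (fun _ : R * R => H)} by exact: cst_continuous.
      have c1 : {for w, continuous (@fst R R)} by exact: cvg_fst.
      have ca : {for w, continuous (fun w : R * R => `|w.1|)}.
        by apply: continuous_comp c1 _; exact: norm_continuous.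
      exact: continuousB cH ca.
    exact: cvg_snd.
Qed.

(** Affine coordinates around the pole, which the strip leaves out and where all fibers meet. *)
Definition pole (w : R * R) : 'rV[R]_3 := vec3 w.1 w.2 1.

Lemma pole_neq0 w : pole w != 0.
Proof.
by apply/eqP => /row3P[_ _]; rewrite vec3E mxE; apply/eqP; rewrite oner_eq0.
Qed.

Lemma pole_chart :
  proj_chart [set v | v 0 ord_max != 0]
    (fun v => (v 0 0 / v 0 ord_max, v 0 1 / v 0 ord_max)) pole setT.
Proof.
split.
- exact: coord_neq0_open.
- move=> a v a0 /= v2; split; first by rewrite mxE mulf_neq0.
  by rewrite !ratio_scale.
- move=> v /= v2; split => //; exists (v 0 ord_max).
  apply/row3P; split; rewrite [RHS]mxE vec3E /=.
  + by field.
  + by field.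
  + by rewrite mulr1.
- split=> [|[a b] _]; first exact: pole_neq0.
  by rewrite /pole /= !vec3E !divr1 oner_neq0.
- split=> [v /set_mem /= v2|].
    exact: (cvg_pair (@ratio_continuous 0 _ v v2) (@ratio_continuous 1 _ v v2)).
  apply: vec3_continuous => w; first exact: cvg_fst.
    exact: cvg_snd.
  exact: cvg_cst.
Qed.

End MoebiusCoordinates.

(** * Curves and their crossings *)

Section Curves.
Context {R : realType}.

Lemma simple_closed_pt (f : R -> 'rV[R]_3) (a b : R) : a < b ->
  continuous f -> (forall t, f t != 0) -> pt (f a) = pt (f b) ->
  {in `[a, b[ &, forall s t k, f s = k *: f t -> s = t} ->
  simple_closed_curve R ((pt \o f) @` `[a, b]).
Proof.
move=> ab cf f0 fab finj; pose l (x : R) := a + x * (b - a).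
have ba0 : 0 < b - a by rewrite subr_gt0.
exists (pt \o f \o l); split.
- apply: continuous_subspaceT; apply: pt_continuous => [x|x]; last exact: f0.
  apply: (@continuous_comp _ _ _ l f); last exact: cf.
  by apply: cvgD; [exact: cvg_cst|apply: cvgM; [exact: cvg_id|exact: cvg_cst]].
- by rewrite /l /= mul0r mul1r addr0 subrKC.
- have lI x : x \in `[0, 1[ -> l x \in `[a, b[.
    by rewrite !in_itv /= /l => /andP[x0 x1]; apply/andP; split; nra.
  move=> x y xI yI /= /(pt_eq (f0 _) (f0 _)).1 [k].
  move=> /(finj _ _ (lI _ xI) (lI _ yI)) /addrI /mulIf; apply.
  exact: lt0r_neq0.
- apply/seteqP; split => _ [t tI <-] /=.
    move: tI; rewrite /= in_itv/= => /andP[at_ tb].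
    exists ((t - a) / (b - a)) => /=; last by rewrite /l divfK ?subrKC// lt0r_neq0.
    rewrite in_itv/= divr_ge0 ?subr_ge0// ?ler_pdivrMr ?mul1r ?lerB//.
    exact: ltW.
  move: tI; rewrite /= in_itv/= => /andP[t0 t1].
  by exists (l t) => //=; rewrite in_itv/= /l; apply/andP; split; nra.
Qed.

(** If |t| < H, the middle coordinates force k >= 0, hence |s| = k |t| and H = k H. If t = -H, they
    force |s| = H, and s = -H since s < H; again k = 1. *)
Lemma mob_scale_inj (H s t z z' k : R) : 0 < H -> - H <= s < H -> - H <= t < H ->
  mob H (s, z) = k *: mob H (t, z') -> s = t /\ z = z'.
Proof.
move=> H0 /andP[Hs sH] /andP[Ht tH] /row3P[]; rewrite !mxE/= => e0 e1 e2.
suff k1 : k = 1 by rewrite e0 e2 k1 !mul1r.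
have sH' : `|s| <= H by rewrite ler_norml Hs ltW.
have [tH'|tH'] := ltP `|t| H.
  have k0 : 0 <= k.
    rewrite leNgt; apply/negP => k0.
    have : k * (H - `|t|) < 0 by rewrite nmulr_rlt0// subr_gt0.
    by lra.
  have sE : `|s| = k * `|t| by rewrite e0 normrM ger0_norm.
  have : H * (k - 1) = 0 by rewrite sE in e1; lra.
  by move=> /eqP; rewrite mulf_eq0 gt_eqF//= subr_eq0 => /eqP.
have tE : t = - H by move: tH'; case: (ger0P t) => ? ?; lra.
have nH : `|- H| = H by rewrite normrN gtr0_norm.
have : `|s| = H by move: e1; rewrite tE nH; lra.
case: (ger0P s) => s0 sE; first by lra.
have : H * (k - 1) = 0 by move: e0; rewrite tE; lra.
by move=> /eqP; rewrite mulf_eq0 gt_eqF//= subr_eq0 => /eqP.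
Qed.

Context (H : R) (H0 : 0 < H).

Definition graph_curve (g : R -> R) : set (RP2 R) :=
  (fun s => pt (mob H (s, g s))) @` `[- H, H].

(** Covers the whole projective line by a compact interval: z = r / (1 - |r|) on the strip, with
    inverse r = z / (1 + |z|), and both ends r = -1 and r = 1 give the pole. *)
Definition fiber_vec (s r : R) : 'rV[R]_3 :=
  vec3 ((1 - `|r|) * s) ((1 - `|r|) * (H - `|s|)) r.

Definition fiber_curve (s : R) : set (RP2 R) :=
  (pt \o fiber_vec s) @` `[- 1, 1].

Definition pole_point : RP2 R := pt (pole (0, 0)).

Lemma pt_mob_inj (s t z z' : R) : - H <= s < H -> - H <= t < H ->
  pt (mob H (s, z)) = pt (mob H (t, z')) -> s = t /\ z = z'.
Proof.
move=> sI tI /(pt_eq (mob_neq0 H0 _) (mob_neq0 H0 _)).1 [k].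
exact: (mob_scale_inj H0).
Qed.

Lemma pt_mob_seam (g : R -> R) : g H = - g (- H) ->
  pt (mob H (- H, g (- H))) = pt (mob H (H, g H)).
Proof.
move=> gH; apply/pt_eq; [exact: mob_neq0|exact: mob_neq0|exists (-1)].
by apply/row3P; split; rewrite !mxE/= ?gH ?normrN ?gtr0_norm//; ring.
Qed.

Lemma graph_curve_closed (g : R -> R) : continuous g -> g H = - g (- H) ->
  simple_closed_curve R (graph_curve g).
Proof.
move=> cg gH; apply: (@simple_closed_pt (fun s => mob H (s, g s))).
- by rewrite gtrN.
- move=> t; apply: (@continuous_comp _ _ _ (fun s => (s, g s)) (mob H)).
    by apply: continuous_pair => // u; exact: cvg_id.
  by have [_ _ _ _ [_ cm]] := mob_chart H0; exact: cm.
- by move=> t; exact: mob_neq0.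
- exact: pt_mob_seam.
- move=> s t; rewrite !in_itv/= => sI tI k /(mob_scale_inj H0)[]//.
Qed.

Lemma fiber_vec_neq0 (s r : R) : fiber_vec s r != 0.
Proof.
apply/eqP => /row3P[]; rewrite !mxE/= => + + r0.
rewrite r0 normr0 subr0 !mul1r => ->.
by rewrite normr0 subr0 => /eqP; rewrite gt_eqF.
Qed.

Lemma pt_pole (k : R) : k != 0 -> pt (vec3 0 0 k) = pole_point.
Proof.
have vk (a : R) : a != 0 -> vec3 0 0 a != 0.
  by move=> a0; apply/eqP => /row3P[_ _]; rewrite !mxE/=; exact/eqP.
move=> k0; apply/pt_eq; [exact: vk|exact/vk/oner_neq0|exists k].
by apply/row3P; rewrite !mxE/= !mulr0 mulr1.
Qed.

Lemma fiber_curve_closed (s : R) : `|s| < H ->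
  simple_closed_curve R (fiber_curve s).
Proof.
move=> sH; apply: simple_closed_pt.
- by lra.
- have cn : continuous (fun r : R => 1 - `|r|).
    move=> r; apply: cvgB; first exact: cvg_cst.
    exact: norm_continuous.
  apply: vec3_continuous => r; last exact: cvg_id.
    by apply: cvgM; [exact: cn|exact: cvg_cst].
  by apply: cvgM; [exact: cn|exact: cvg_cst].
- exact: fiber_vec_neq0.
- rewrite /fiber_vec normrN normr1 subrr !mul0r !pt_pole ?oppr_eq0 ?oner_neq0//.
- move=> r t; rewrite !in_itv/= => rI tI k /row3P[]; rewrite !mxE/= => _ e1 e2.
  (* Up to the factor H - |s|, the last two coordinates are 1 - |r| and r, which are those of
     [mob 1 (r, 0)]. *)
  suff /(mob_scale_inj ltr01 rI tI)[] : mob 1 (r, 0) = k *: mob 1 (t, 0) by [].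
  apply/row3P; rewrite !mxE/= mulr0; split => //.
  apply: (@mulIf _ (H - `|s|)); first by rewrite gt_eqF// subr_gt0.
  by rewrite e1 mulrA.
Qed.

Lemma fiber_curveE (s : R) (p : RP2 R) :
  fiber_curve s p <-> p = pole_point \/ exists z, p = pt (mob H (s, z)).
Proof.
split=> [[r /= + <-]|[->|[z ->]]].
- rewrite in_itv/= -ler_norml le_eqVlt => /orP[/eqP r1|r1].
    left; rewrite /fiber_vec r1 subrr !mul0r pt_pole//.
    by rewrite -normr_gt0 r1.
  have r1' : 1 - `|r| != 0 by rewrite gt_eqF// subr_gt0.
  right; exists (r / (1 - `|r|)).
  apply/pt_eq; [exact: fiber_vec_neq0|exact: mob_neq0|exists (1 - `|r|)].
  by apply/row3P; rewrite !mxE/=; split => //; rewrite mulrC divfK.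
- exists 1; first by rewrite /= in_itv/=; lra.
  by rewrite /= /fiber_vec normr1 subrr !mul0r pt_pole// oner_neq0.
- have z0 := normDS_gt0 z; have z0' := lt0r_neq0 z0.
  have nz : `|z / (1 + `|z|)| = `|z| / (1 + `|z|).
    by rewrite normrM normfV (gtr0_norm z0).
  have z1 : 1 - `|z| / (1 + `|z|) = (1 + `|z|)^-1 by field.
  exists (z / (1 + `|z|)).
    rewrite /= in_itv/= -ler_norml nz ler_pdivrMr// mul1r; lra.
  apply/pt_eq; [exact: fiber_vec_neq0|exact: mob_neq0|exists (1 + `|z|)^-1].
  by apply/row3P; rewrite !mxE/= nz z1; split => //; rewrite mulrC.
Qed.

Lemma mob_neq_pole w : `|w.1| <= H -> pt (mob H w) <> pole_point.
Proof.
move=> wH /(pt_eq (mob_neq0 H0 _) (pole_neq0 _)).1 [k /row3P[]].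
rewrite !mxE/= !mulr0 => -> /eqP.
by rewrite normr0 subr0 gt_eqF.
Qed.

Lemma fiber_curve_mob (s t z : R) : `|s| < H -> - H <= t < H ->
  fiber_curve s (pt (mob H (t, z))) <-> t = s.
Proof.
move=> sH tI; have sI : - H <= s < H.
  by move: sH; rewrite ltr_norml => /andP[/ltW -> ->].
rewrite fiber_curveE; split=> [[/mob_neq_pole[]|[z' /pt_mob_inj[]]]//|->].
  by rewrite /= ler_norml; case/andP: tI => -> /ltW ->.
by right; exists z.
Qed.

(** The seam point is kept at s = -H only, so that every point has a single parameter. *)
Lemma graph_curveE (g : R -> R) (p : RP2 R) : g H = - g (- H) ->
  graph_curve g p <-> exists2 s, - H <= s < H & p = pt (mob H (s, g s)).
Proof.
move=> gH; split=> [[s /= + <-]|[s /andP[Hs sH] ->]]; last first.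
  by exists s => //=; rewrite in_itv/= Hs ltW.
rewrite in_itv/= => /andP[Hs]; rewrite le_eqVlt => /orP[/eqP ->|sH].
  by exists (- H); rewrite ?pt_mob_seam// lexx gtrN.
by exists s; rewrite ?Hs.
Qed.

Lemma graph_curve_mob (g : R -> R) (t z : R) :
  g H = - g (- H) -> - H <= t < H ->
  graph_curve g (pt (mob H (t, z))) <-> z = g t.
Proof.
move=> gH tI; rewrite graph_curveE//; split=> [[s sI /pt_mob_inj[]//->//]|->].
by exists t.
Qed.

End Curves.

(** * Crossings of graphs and fibers *)

Section Crossings.
Context {R : realType} (H : R) (H0 : 0 < H).

Lemma open_norm_lt (f : R * R -> R) (e : R) :
  continuous f -> open [set w | `|f w| < e].
Proof.
move=> cf; have cn : continuous (fun w => `|f w|).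
  by move=> w; apply: continuous_comp (cf w) _; exact: norm_continuous.
by move/continuousP : cn => /(_ _ (@open_lt _ e)).
Qed.

(** The heights z - h(s) and z - g(s) above the two graphs are local coordinates: their difference
    g(s) - h(s) = c (s - T) gives s back, because c is nonzero. *)
Lemma graph_graph_cross (g h : R -> R) (T c e : R) :
  continuous g -> continuous h -> g H = - g (- H) -> h H = - h (- H) ->
  `|T| < H -> (forall s, - H <= s < H -> g s = h s -> s = T) ->
  c != 0 -> 0 < e -> (forall s, `|s - T| < e -> g s - h s = c * (s - T)) ->
  graph_curve H g `&` graph_curve H h = [set pt (mob H (T, g T))] /\
  cross_at R (graph_curve H g) (graph_curve H h) (pt (mob H (T, g T))).
Proof.
move=> cg ch gH hH TH uniqT c0 e0 lin.
have I (s : R) : `|s| < H -> - H <= s < H by rewrite ltr_norml => /andP[/ltW -> ->].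
have ghT : g T = h T.
  by apply/eqP; rewrite -subr_eq0 lin ?subrr ?mulr0// normr0.
split.
  apply/seteqP; split=> [p []|_ ->].
    move=> /(graph_curveE H0 _ gH).1[s sI ->] /(graph_curve_mob H0 _ hH sI).1.
    by move=> /(uniqT _ sI) ->.
  by split; [rewrite graph_curve_mob//; exact: I|rewrite graph_curve_mob//; exact: I].
pose phi (w : R * R) := (w.2 - h w.1, w.2 - g w.1).
pose l (v : R * R) := T + c^-1 * (v.1 - v.2).
pose psi (v : R * R) := (l v, v.2 + g (l v)).
pose U := [set w : R * R | `|w.1| < H] `&` [set w | `|w.1 - T| < e].
have c1 : continuous (@fst R R) by move=> w; exact: cvg_fst.
have c2 : continuous (@snd R R) by move=> w; exact: cvg_snd.
have oU : open U.
  apply: openI; first exact: open_norm_lt c1.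
  by apply: open_norm_lt => w; apply: cvgB; [exact: c1|exact: cvg_cst].
have cl : continuous l.
  move=> v; apply: cvgD; first exact: cvg_cst.
  apply: cvgM; first exact: cvg_cst.
  by apply: cvgB; [exact: c1|exact: c2].
have cpsi : continuous psi.
  apply: continuous_pair => // v; apply: cvgD; first exact: c2.
  by apply: (@continuous_comp _ _ _ l g); [exact: cl|exact: cg].
have cphi : continuous phi.
  by apply: continuous_pair => w; (apply: cvgB; first exact: c2);
    [apply: (@continuous_comp _ _ _ fst h)|apply: (@continuous_comp _ _ _ fst g)];
    by [exact: c1|exact: ch|exact: cg].
have oW : open (psi @^-1` U) by move/continuousP : cpsi; exact.
have psiK v : U (psi v) -> phi (psi v) = v.
  move=> [_ /= /lin]; rewrite /phi /psi /= {2}/l (addrAC T) subrr add0r.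
  rewrite mulVKf// => ghl; rewrite [RHS]surjective_pairing; congr (_, _); last by ring.
  by rewrite -addrA ghl; ring.
have phiK w : U w -> psi (phi w) = w.
  move=> [_ /= /lin ghw]; rewrite /psi /phi /l /=.
  have -> : T + c^-1 * (w.2 - h w.1 - (w.2 - g w.1)) = w.1.
    have -> : w.2 - h w.1 - (w.2 - g w.1) = g w.1 - h w.1 by ring.
    by rewrite ghw mulKf// subrKC.
  by rewrite subrK -surjective_pairing.
apply: (@cross_in_chart _ _ _ _ _ U (psi @^-1` U) phi psi _ _ (T, g T)
  (mob_chart H0)) => //.
- by move=> w [].
- by move=> w Uw; rewrite /= phiK.
- by move=> v Wv; rewrite psiK.
- move=> [s z] [/= /I sI _]; rewrite !graph_curve_mob// /phi /=.
  by split; split=> [->|/eqP]; rewrite ?subrr// subr_eq0 => /eqP.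
- by split; rewrite //= subrr normr0.
- by rewrite /phi /= ghT subrr.
Qed.

(** The shear (s - T, z - g(s)) sends the graph and the fiber to the axes. *)
Lemma graph_fiber_cross (g : R -> R) (T : R) :
  continuous g -> g H = - g (- H) -> `|T| < H ->
  graph_curve H g `&` fiber_curve H T = [set pt (mob H (T, g T))] /\
  cross_at R (graph_curve H g) (fiber_curve H T) (pt (mob H (T, g T))).
Proof.
move=> cg gH TH.
have I (s : R) : `|s| < H -> - H <= s < H by rewrite ltr_norml => /andP[/ltW -> ->].
split.
  apply/seteqP; split=> [p []|_ ->].
    move=> /(graph_curveE H0 _ gH).1[s sI ->].
    by move=> /(fiber_curve_mob H0 _ TH sI).1 ->.
  by split; [rewrite graph_curve_mob//; exact: I|rewrite fiber_curve_mob//; exact: I].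
pose phi (w : R * R) := (w.1 - T, w.2 - g w.1).
pose l (v : R * R) := v.1 + T.
pose psi (v : R * R) := (l v, v.2 + g (l v)).
pose U := [set w : R * R | `|w.1| < H].
have c1 : continuous (@fst R R) by move=> w; exact: cvg_fst.
have c2 : continuous (@snd R R) by move=> w; exact: cvg_snd.
have oU : open U by exact: open_norm_lt c1.
have cl : continuous l.
  by move=> v; apply: cvgD; [exact: c1|exact: cvg_cst].
have cpsi : continuous psi.
  apply: continuous_pair => // v; apply: cvgD; first exact: c2.
  by apply: (@continuous_comp _ _ _ l g); [exact: cl|exact: cg].
have cphi : continuous phi.
  apply: continuous_pair => w; apply: cvgB; [exact: c1|exact: cvg_cst|exact: c2|].
  by apply: (@continuous_comp _ _ _ fst g); [exact: c1|exact: cg].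
have psiK v : phi (psi v) = v by rewrite /phi /psi /= /l !addrK -surjective_pairing.
have phiK w : psi (phi w) = w by rewrite /phi /psi /l /= !subrK -surjective_pairing.
have oW : open (psi @^-1` U) by move/continuousP : cpsi; exact.
apply: (@cross_in_chart _ _ _ _ _ U (psi @^-1` U) phi psi _ _ (T, g T)
  (mob_chart H0)) => //.
- by move=> w Uw; rewrite /= phiK.
- move=> [s z] /= Us; have sI := I _ Us; rewrite graph_curve_mob// fiber_curve_mob//.
  by rewrite /phi /=; split; split=> [->|/eqP]; rewrite ?subrr// subr_eq0 => /eqP.
- by rewrite /phi /= !subrr.
Qed.

(** Around the pole the fiber is the straight line through the origin directed by (s, H - |s|). *)
Lemma fiber_curve_pole (s a b : R) : `|s| < H ->
  fiber_curve H s (pt (pole (a, b))) <-> a * (H - `|s|) = b * s.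
Proof.
move=> sH; have A0 : H - `|s| != 0 by rewrite gt_eqF// subr_gt0.
rewrite fiber_curveE//; split.
  case=> [|[z]].
    move=> /(pt_eq (pole_neq0 _) (pole_neq0 _)).1[k /row3P[]].
    by rewrite !mxE/= !mulr0 => -> -> _; rewrite !mul0r.
  move=> /(pt_eq (pole_neq0 _) (mob_neq0 H0 _)).1[k /row3P[]].
  by rewrite !mxE/= => -> -> _; rewrite mulrAC.
move=> ab; have [b0|b0] := eqVneq b 0.
  left; move: ab; rewrite b0 mul0r => /eqP.
  by rewrite mulf_eq0 (negbTE A0) orbF => /eqP ->.
right; exists ((H - `|s|) / b).
apply/pt_eq; [exact: pole_neq0|exact: mob_neq0|exists (b / (H - `|s|))].
apply/row3P; rewrite !mxE/=; split; last by field; rewrite A0 b0.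
  by rewrite mulrAC -ab mulfK.
by rewrite divfK.
Qed.

Lemma fiber_fiber_cross (s t : R) : `|s| < H -> `|t| < H -> s != t ->
  fiber_curve H s `&` fiber_curve H t = [set pole_point] /\
  cross_at R (fiber_curve H s) (fiber_curve H t) pole_point.
Proof.
move=> sH tH st.
have I (u : R) : `|u| < H -> - H <= u < H by rewrite ltr_norml => /andP[/ltW -> ->].
split.
  apply/seteqP; split=> [p []|_ ->].
    move=> /(fiber_curveE H0 _ _).1[->//|[z ->]].
    by move=> /(fiber_curve_mob H0 _ tH (I _ sH)).1 /eqP; rewrite (negbTE st).
  by split; apply/(fiber_curveE H0); left.
(* [D] is the determinant of the directions (s, A) and (t, B) of the two lines; it is nonzero
   because [mob] gives non-proportional vectors. The maps below are linear and inverse by Cramer's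
   rule. *)
pose A := H - `|s|; pose B := H - `|t|; pose D := s * B - t * A.
have B0 : B != 0 by rewrite gt_eqF// subr_gt0.
have D0 : D != 0.
  apply: contra_neq st => /eqP; rewrite subr_eq0 => /eqP sBtA.
  have [] // := @mob_scale_inj _ H s t 0 0 (A / B) H0 (I _ sH) (I _ tH).
  apply/row3P; rewrite !mxE/= mulr0; split => //; last by rewrite divfK.
  by apply: (mulIf B0); rewrite sBtA mulrAC divfK// mulrC.
pose phi (w : R * R) := (w.1 * B - w.2 * t, w.1 * A - w.2 * s).
pose psi (v : R * R) := (D^-1 * (v.1 * s - v.2 * t), D^-1 * (v.1 * A - v.2 * B)).
have clin (a b : R) : continuous (fun w : R * R => w.1 * a - w.2 * b).
  move=> w; apply: cvgB; apply: cvgM; try exact: cvg_cst.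
    exact: cvg_fst.
  exact: cvg_snd.
have cphi : continuous phi by apply: continuous_pair; exact: clin.
have cpsi : continuous psi.
  by apply: continuous_pair => w; apply: cvgM; try exact: cvg_cst; exact: clin.
apply: (@cross_in_chart _ _ _ _ _ setT setT phi psi _ _ (0, 0) pole_chart) => //.
- exact: openT.
- exact: openT.
- by move=> [a b] _; split => //; congr (_, _) => /=; move: D0; rewrite /D => ?; field.
- by move=> [a b] _; split => //; congr (_, _) => /=; move: D0; rewrite /D => ?; field.
- move=> [a b] _; rewrite !fiber_curve_pole// /phi /=.
  by split; split=> [->|/eqP]; rewrite ?subrr// subr_eq0 => /eqP.
- by rewrite /phi /= !mul0r subrr.
Qed.

End Crossings.

(** * The sides of the two polygons *)

Section Sides.
Context {R : realType} (M : nat).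

(* Fibers are at even ticks, centers of sides at multiples of 4; the shift by
   1/4 keeps all crossings away from the seam [s = +-M]. *)
Definition tick (n : nat) : R := - M%:R + 4^-1 + n%:R / 2.

Definition side (k : R) (a : nat) (x : R) : R := k * (M%:R - `|x - tick (4 * a)|).

Definition sg (b : bool) : R := if b then -1 else 1.

Lemma side_continuous k a : continuous (side k a).
Proof.
move=> x; apply: cvgM; first exact: cvg_cst.
apply: cvgB; first exact: cvg_cst.
have cs : {for x, continuous (fun x => x - tick (4 * a))}.
  by apply: cvgB; [exact: cvg_id|exact: cvg_cst].
by apply: continuous_comp cs _; exact: norm_continuous.
Qed.

(** The ticks 0 to 4 M - 1 run from -M + 1/4 to M - 1/4. *)
Lemma tick_lt (n : nat) : (n < 4 * M)%N -> `|tick n| < M%:R.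
Proof.
move=> nM; have : n.+1%:R <= (4 * M)%:R :> R by rewrite ler_nat.
rewrite -natr1 natrM; have := ler0n R n; rewrite ltr_norml /tick => ? ?; apply/andP; split; lra.
Qed.

(** For a center c with |c| < M, the distances from c to M and to -M add up to 2 M. *)
Lemma side_seam k a : (a < M)%N -> side k a M%:R = - side k a (- M%:R).
Proof.
move=> aM; have : `|tick (4 * a)| < M%:R by rewrite tick_lt// ltn_pmul2l.
rewrite /side ltr_norml => /andP[? ?].
rewrite (@ger0_norm _ (M%:R - _)) ?subr_ge0 ?ltW//.
rewrite (@ler0_norm _ (- M%:R - _)) ?subr_le0 ?ltW//; ring.
Qed.

(* Near [tick n] the sides are affine, of slopes [- k1 * sg b1] and
   [- k2 * sg b2], where [b1] and [b2] tell on which side of the centers we are. *)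
Lemma sides_cross (k1 k2 : R) (a1 a2 n : nat) (b1 b2 : bool) :
  (n < 4 * M)%N -> (a1 < M)%N -> (a2 < M)%N ->
  (if b1 then n < 4 * a1 else 4 * a1 < n)%N ->
  (if b2 then n < 4 * a2 else 4 * a2 < n)%N ->
  k1 * sg b1 != k2 * sg b2 ->
  side k1 a1 (tick n) = side k2 a2 (tick n) ->
  (forall s, - M%:R <= s < M%:R -> side k1 a1 s = side k2 a2 s -> s = tick n) ->
  let p := pt (mob M%:R (tick n, side k1 a1 (tick n))) in
  graph_curve M%:R (side k1 a1) `&` graph_curve M%:R (side k2 a2) = [set p] /\
  cross_at R (graph_curve M%:R (side k1 a1)) (graph_curve M%:R (side k2 a2)) p.
Proof.
move=> nM aM1 aM2 nb1 nb2 k12 gT uniqT /=.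
have M0 : 0 < M%:R :> R by rewrite ltr0n; lia.
(* Consecutive ticks are 1/2 apart and [tick n] is not the center, so the center is not met within
   1/2 of it. *)
have lin k a (b : bool) : (if b then n < 4 * a else 4 * a < n)%N ->
    forall s, `|s - tick n| < 2^-1 ->
    side k a s = k * (M%:R - sg b * (s - tick (4 * a))).
  rewrite /side /sg => nb s; rewrite ltr_norml => /andP[s1 s2]; congr (_ * (_ - _)).
  case: b nb => nb.
    have : n%:R + 1 <= (4 * a)%:R :> R by rewrite natr1 ler_nat.
    by move: s1 s2; rewrite /tick => ? ? ?; rewrite ler0_norm; lra.
  have : (4 * a)%:R + 1 <= n%:R :> R by rewrite natr1 ler_nat.
  by move: s1 s2; rewrite /tick => ? ? ?; rewrite ger0_norm; lra.
have lin1 := lin k1 _ _ nb1; have lin2 := lin k2 _ _ nb2.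
have T2 : `|tick n - tick n| < 2^-1 by rewrite subrr normr0 invr_gt0.
apply: (@graph_graph_cross R M%:R M0 _ _ (tick n) (k2 * sg b2 - k1 * sg b1) 2^-1).
- exact: side_continuous.
- exact: side_continuous.
- exact: side_seam.
- exact: side_seam.
- exact: tick_lt.
- exact: uniqT.
- by rewrite subr_eq0 eq_sym.
- by rewrite invr_gt0.
- move=> s sT; rewrite lin1// lin2//.
  move/eqP : gT; rewrite lin1// lin2// -subr_eq0 => /eqP gT.
  by rewrite -[RHS]addr0 -[X in _ = _ + X]gT; ring.
Qed.

End Sides.

(** * The tick at which two sides cross *)

Section SideCrossings.
Context {R : realType} (M : nat).
Local Notation tick := (@tick R M).
Local Notation side := (@side R M).
Local Notation sg := (@sg R).

(** Keeps the index [n], whose parity tells whether the crossing is on a fiber. *)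
Definition meet_at (k1 : R) (a1 : nat) (k2 : R) (a2 n : nat) : Prop :=
  let p := pt (mob M%:R (tick n, side k1 a1 (tick n))) in
  [/\ (n < 4 * M)%N, side k1 a1 (tick n) = side k2 a2 (tick n),
      graph_curve M%:R (side k1 a1) `&` graph_curve M%:R (side k2 a2) = [set p] &
      cross_at R (graph_curve M%:R (side k1 a1))
                 (graph_curve M%:R (side k2 a2)) p].

Lemma meet_atI (k1 k2 : R) (a1 a2 n : nat) (b1 b2 : bool) :
  (n < 4 * M)%N -> (a1 < M)%N -> (a2 < M)%N ->
  (if b1 then n < 4 * a1 else 4 * a1 < n)%N ->
  (if b2 then n < 4 * a2 else 4 * a2 < n)%N ->
  k1 * sg b1 != k2 * sg b2 ->
  side k1 a1 (tick n) = side k2 a2 (tick n) ->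
  (forall s, - M%:R <= s < M%:R -> side k1 a1 s = side k2 a2 s -> s = tick n) ->
  meet_at k1 a1 k2 a2 n.
Proof.
by move=> nM aM1 aM2 nb1 nb2 k12 gT uniqT; have [] := sides_cross nM aM1 aM2 nb1 nb2 k12 gT uniqT.
Qed.

Lemma natr_eq (m n : nat) : m = n -> m%:R = n%:R :> R.
Proof. by move=> ->. Qed.

Lemma natr_le (m n : nat) : (m <= n)%N -> m%:R <= n%:R :> R.
Proof. by rewrite ler_nat. Qed.

Lemma sg_neq0 b : sg b != 0.
Proof. by case: b; rewrite /sg ?oppr_eq0 oner_eq0. Qed.

(** Equal heights mean equal distances to the two centers, hence the midpoint, an even tick. *)
Lemma meet_same (k : R) a1 a2 : k != 0 -> (a1 < a2)%N -> (a2 < M)%N ->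
  meet_at k a1 k a2 (2 * (a1 + a2)).
Proof.
move=> k0 a12 aM.
have := natr_le a12; have := natr_le aM; have := ler0n R a1.
rewrite -!(natr1 a2) -!natr1 => a10 aM' a12'.
have E s : side k a1 s = side k a2 s -> `|s - tick (4 * a1)| = `|s - tick (4 * a2)|.
  by move=> /(mulfI k0)/(addrI)/oppr_inj.
apply: (@meet_atI _ _ _ _ _ false true) => //=; try lia.
- by rewrite /sg mulr1 mulrN1 -subr_eq0 opprK -mulr2n mulrn_eq0.
- rewrite /side /tick !(natrM, natrD); congr (_ * (_ - _)).
  by rewrite ger0_norm ?ler0_norm; lra.
- move=> s _ /E; rewrite /tick !(natrM, natrD).
  by do 2 case: ger0P => ?; lra.
Qed.

(** Height 0 occurs at distance M, or 2 M ticks, from the center; just one of the ticks 4 a + 2 M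
    and 4 a - 2 M is in the strip. *)
Lemma meet_zero (k : R) a : k != 0 -> (a < M)%N ->
  exists2 n, ~~ odd n & meet_at 0 a k a n.
Proof.
move=> k0 aM; have a0 := ler0n R a; have := natr_le aM; rewrite -natr1 => aM'.
have E s : side 0 a s = side k a s -> `|s - tick (4 * a)| = M%:R.
  rewrite /side mul0r => /esym/eqP.
  by rewrite mulf_eq0 (negbTE k0) subr_eq0 => /eqP.
have [aM2|aM2] := ltnP (2 * a) M; [exists (2 * (2 * a + M))%N|exists (2 * (2 * a - M))%N];
  try by rewrite oddM.
- have := natr_le aM2; rewrite -natr1 natrM => aM2'.
  apply: (@meet_atI _ _ _ _ _ false false) => //=; try lia.
  + by rewrite mul0r eq_sym mulf_neq0// ?oppr_eq0 oner_neq0.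
  + rewrite /side mul0r /tick !(natrM, natrD).
    by rewrite ger0_norm; [field|lra].
  + move=> s sI /E; rewrite /tick !(natrM, natrD).
    by case: ger0P => ?; lra.
- have := natr_le aM2; rewrite natrM => aM2'.
  apply: (@meet_atI _ _ _ _ _ true true) => //=; try lia.
  + by rewrite mul0r eq_sym mulf_neq0// ?oppr_eq0 oner_neq0.
  + rewrite /side mul0r /tick !natrM natrB// !natrM.
    by rewrite ler0_norm; [field|lra].
  + move=> s sI /E; rewrite /tick !natrM natrB// !natrM.
    by case: ger0P => ?; lra.
Qed.

(** The distances to the centers add up to 2 M, which happens M away from their midpoint on either
    side; just one of these places is in the strip. *)
Lemma meet_opp (k : R) a1 a2 : k != 0 -> (a1 < M)%N -> (a2 < M)%N ->
  exists2 n, ~~ odd n & meet_at k a1 (- k) a2 n.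
Proof.
move=> k0 aM1 aM2; have a10 := ler0n R a1; have a20 := ler0n R a2.
have := natr_le aM1; have := natr_le aM2; rewrite -!natr1 => aM2' aM1'.
have E s : side k a1 s = side (- k) a2 s ->
    `|s - tick (4 * a1)| + `|s - tick (4 * a2)| = 2 * M%:R.
  rewrite /side mulNr -mulrN => /(mulfI k0); lra.
have kk : k + k != 0 by rewrite -mulr2n mulrn_eq0.
have [aM|aM] := ltnP (a1 + a2) M; [exists (2 * (a1 + a2 + M))%N|exists (2 * (a1 + a2 - M))%N];
  try by rewrite oddM.
- have := natr_le aM; rewrite -natr1 natrD => aM'.
  apply: (@meet_atI _ _ _ _ _ false false) => //=; try lia.
  + by rewrite /sg !mulr1 -subr_eq0 opprK.
  + rewrite /side mulNr -mulrN; congr (_ * _); rewrite /tick !(natrM, natrD).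
    by do 2 (rewrite ger0_norm; last lra); lra.
  + move=> s sI /E; rewrite /tick !(natrM, natrD).
    by do 2 case: ger0P => ?; lra.
- have := natr_le aM; rewrite natrD => aM'.
  apply: (@meet_atI _ _ _ _ _ true true) => //=; try lia.
  + by rewrite /sg !mulrN1 opprK -subr_eq0 -opprD oppr_eq0.
  + rewrite /side mulNr -mulrN; congr (_ * _); rewrite /tick !natrM natrB// !natrD.
    by do 2 (rewrite ler0_norm; last lra); lra.
  + move=> s sI /E; rewrite /tick !natrM natrB// !natrD.
    by do 2 case: ger0P => ?; lra.
Qed.

(** Dividing by the sign of the flat side leaves only the ratio [e], equal to 3 or -3, in the
    equation. *)
Lemma meet13I (e1 e2 : bool) a b n (b1 b2 : bool) :
  let e := sg (e1 (+) e2) * 3 in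
  (n < 4 * M)%N -> (a < M)%N -> (b < M)%N ->
  (if b1 then n < 4 * a else 4 * a < n)%N ->
  (if b2 then n < 4 * b else 4 * b < n)%N ->
  M%:R - sg b1 * (tick n - tick (4 * a)) = e * (M%:R - sg b2 * (tick n - tick (4 * b))) ->
  (forall s, - M%:R <= s < M%:R ->
    M%:R - `|s - tick (4 * a)| = e * (M%:R - `|s - tick (4 * b)|) -> s = tick n) ->
  meet_at (sg e1) a (sg e2 * 3) b n.
Proof.
move=> e nM aM bM nb1 nb2 gT uniqT.
have E s : side (sg e1) a s = side (sg e2 * 3) b s <->
    M%:R - `|s - tick (4 * a)| = e * (M%:R - `|s - tick (4 * b)|).
  by rewrite /side /e; case: (e1); case: (e2); rewrite /sg /=; split; lra.
have absE c (d : bool) : (if d then n < 4 * c else 4 * c < n)%N ->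
    `|tick n - tick (4 * c)| = sg d * (tick n - tick (4 * c)).
  rewrite /sg /tick; case: d => /natr_le; rewrite -natr1 => ?.
    by rewrite ler0_norm; lra.
  by rewrite ger0_norm; lra.
apply: (@meet_atI _ _ _ _ _ b1 b2) => //.
- by case: (e1); case: (e2); case: (b1); case: (b2); rewrite /sg; lra.
- by apply/E; rewrite (absE _ _ nb1) (absE _ _ nb2).
- by move=> s sI /E; exact: uniqT.
Qed.


(** Solves u = 3 v - 2 M for each position of the tick relative to the centers. There is one root on
    either side of the steep center; comparing a + M with 3 b tells which one is in the strip. *)
Lemma meet13_same (e1 e2 : bool) (a b n : nat) : e1 (+) e2 = false ->
  (a < M)%N -> (b < M)%N -> (n < 4 * M)%N ->
  [\/ [/\ a + M <= 3 * b, n + 2 * (a + M) = 2 * (3 * b), n < 4 * a & n < 4 * b],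
      [/\ a + M <= 3 * b, n + M = 3 * b + a, 4 * a < n & n < 4 * b],
      [/\ 3 * b < a + M, n + 2 * a = 2 * (3 * b + M), 4 * a < n & 4 * b < n] |
      [/\ 3 * b < a + M, n = 3 * b + a + M, n < 4 * a & 4 * b < n]]%N ->
  meet_at (sg e1) a (sg e2 * 3) b n.
Proof.
move=> e12 aM bM nM; have a0 := ler0n R a; have b0 := ler0n R b.
have ltE (x y : nat) : (x < y)%N -> x%:R + 1 <= y%:R :> R by rewrite natr1 ler_nat.
have aM' := ltE _ _ aM; have bM' := ltE _ _ bM.
case=> -[s1 nE n1 n2]; have nE' := natr_eq nE; rewrite !(natrM, natrD) in nE';
  [have s1' := natr_le s1|have s1' := natr_le s1|have s1' := ltE _ _ s1|have s1' := ltE _ _ s1];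
  rewrite !(natrM, natrD) in s1';
  have n1' := ltE _ _ n1; have n2' := ltE _ _ n2; rewrite !natrM in n1' n2';
  [apply: (@meet13I _ _ _ _ _ true true)|apply: (@meet13I _ _ _ _ _ false true)
  |apply: (@meet13I _ _ _ _ _ false false)|apply: (@meet13I _ _ _ _ _ true false)];
  rewrite ?e12; try assumption; rewrite /sg /tick !(natrM, natrD);
  clear aM bM nM s1 nE n1 n2 e12 ltE;
  try (move=> s /andP[sl sr]; do 2 case: ger0P => ?); lra.
Qed.

(** Same analysis for u + 3 v = 4 M, where comparing a + 3 b with 2 M selects the root. *)
Lemma meet13_opp (e1 e2 : bool) (a b n : nat) : e1 (+) e2 = true ->
  (a < M)%N -> (b < M)%N -> (n < 4 * M)%N ->
  [\/ [/\ 2 * M <= a + 3 * b, n + 2 * M = a + 3 * b, n < 4 * a & n < 4 * b],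
      [/\ 2 * M <= a + 3 * b, n + 2 * (a + 2 * M) = 2 * (3 * b), 4 * a < n & n < 4 * b],
      [/\ a + 3 * b < 2 * M, n = a + 3 * b + 2 * M, 4 * a < n & 4 * b < n] |
      [/\ a + 3 * b < 2 * M, n + 2 * a = 2 * (3 * b + 2 * M), n < 4 * a & 4 * b < n]]%N ->
  meet_at (sg e1) a (sg e2 * 3) b n.
Proof.
move=> e12 aM bM nM; have a0 := ler0n R a; have b0 := ler0n R b.
have ltE (x y : nat) : (x < y)%N -> x%:R + 1 <= y%:R :> R by rewrite natr1 ler_nat.
have aM' := ltE _ _ aM; have bM' := ltE _ _ bM.
case=> -[s1 nE n1 n2]; have nE' := natr_eq nE; rewrite !(natrM, natrD) in nE';
  [have s1' := natr_le s1|have s1' := natr_le s1|have s1' := ltE _ _ s1|have s1' := ltE _ _ s1];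
  rewrite !(natrM, natrD) in s1';
  have n1' := ltE _ _ n1; have n2' := ltE _ _ n2; rewrite !natrM in n1' n2';
  [apply: (@meet13I _ _ _ _ _ true true)|apply: (@meet13I _ _ _ _ _ false true)
  |apply: (@meet13I _ _ _ _ _ false false)|apply: (@meet13I _ _ _ _ _ true false)];
  rewrite ?e12; try assumption; rewrite /sg /tick !(natrM, natrD);
  clear aM bM nM s1 nE n1 n2 e12 ltE;
  try (move=> s /andP[sl sr]; do 2 case: ger0P => ?); lra.
Qed.

End SideCrossings.

(** * Crossings of sides of different classes, on and off the fibers *)

Section UnequalSides.
Context {R : realType} (j : nat).
Local Notation M := (3 * j + 1)%N.
Local Notation tick := (@tick R M).
Local Notation sg := (@sg R).

(* [offset b3 k / 2] is the distance between the center of a side and its k-th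
   vertex off the fibers, for the steep ([b3 = true]) and the flat class. *)
Definition offset (b3 : bool) (k : nat) : nat :=
  if b3 then 4 * j + 3 + 2 * k else 5 + 6 * k.

(** A turn around the strip is 4 M ticks; the last two alternatives wrap around the seam. Below 4 M
    at most 2 M + 2 j ticks qualify. *)
Definition on_time (b3 : bool) (a n : nat) : Prop :=
  ~~ odd n \/ exists2 k, (k < j)%N &
    [\/ n = 4 * a + offset b3 k, n + offset b3 k = 4 * a,
        n + 4 * M = 4 * a + offset b3 k | n + offset b3 k = 4 * a + 4 * M]%N.

(** With distances in ticks, u = 3 v - 4 M, and v = 4 j + 3 + 2 k gives u = 5 + 6 k: the same [k]
    serves both sides. *)
Lemma time_same (a b : nat) : (a < M)%N -> (b < M)%N ->
  exists n, [/\ (n < 4 * M)%N, on_time false a n, on_time true b n &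
    [\/ [/\ a + M <= 3 * b, n + 2 * (a + M) = 2 * (3 * b), n < 4 * a & n < 4 * b],
        [/\ a + M <= 3 * b, n + M = 3 * b + a, 4 * a < n & n < 4 * b],
        [/\ 3 * b < a + M, n + 2 * a = 2 * (3 * b + M), 4 * a < n & 4 * b < n] |
        [/\ 3 * b < a + M, n = 3 * b + a + M, n < 4 * a & 4 * b < n]]%N].
Proof.
move=> aM bM; have [s1|s1] := leqP (a + M) (3 * b).
- have [s2|s2] := ltnP (3 * b) (3 * a + M).
    exists (2 * (3 * b - (a + M)))%N; split; try (by left; rewrite oddM); first lia.
    by constructor 1; split; lia.
  exists (3 * b + a - M)%N; split; first lia; last by constructor 2; split; lia.
  + have [on|on] := boolP (odd (3 * b + a - M)); [right|by left].
    (* An odd tick makes b - a - j even, and [s2] makes it positive. *)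
    have [q qE] : exists q, (b = a + j + 2 * q.+1)%N.
      by exists ((b - a - j)./2.-1)%N; lia.
    by exists q; rewrite /offset; [lia|constructor 1; lia].
  + have [on|on] := boolP (odd (3 * b + a - M)); [right|by left].
    have [q qE] : exists q, (b = a + j + 2 * q.+1)%N.
      by exists ((b - a - j)./2.-1)%N; lia.
    by exists q; rewrite /offset; [lia|constructor 2; lia].
- have [s2|s2] := ltnP (3 * a) (3 * b + M).
    exists (2 * (3 * b + M - a))%N; split; try (by left; rewrite oddM); first lia.
    by constructor 3; split; lia.
  exists (3 * b + a + M)%N; split; first lia; last by constructor 4; split; lia.
  + have [on|on] := boolP (odd (3 * b + a + M)); [right|by left].
    have [q qE] : exists q, (a = b + j + 2 * q.+1)%N.
      by exists ((a - b - j)./2.-1)%N; lia.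
    by exists q; rewrite /offset; [lia|constructor 2; lia].
  + have [on|on] := boolP (odd (3 * b + a + M)); [right|by left].
    have [q qE] : exists q, (a = b + j + 2 * q.+1)%N.
      by exists ((a - b - j)./2.-1)%N; lia.
    by exists q; rewrite /offset; [lia|constructor 1; lia].
Qed.

(** With distances in ticks, u + 3 v = 8 M. Off the fibers exactly one distance is taken across the
    seam, as its complement to 4 M: v = 4 j + 3 + 2 k goes with 4 M - u = 5 + 6 k, and likewise 4 M
    - v with u. *)
Lemma time_opp (a b : nat) : (a < M)%N -> (b < M)%N ->
  exists n, [/\ (n < 4 * M)%N, on_time false a n, on_time true b n &
    [\/ [/\ 2 * M <= a + 3 * b, n + 2 * M = a + 3 * b, n < 4 * a & n < 4 * b],
        [/\ 2 * M <= a + 3 * b, n + 2 * (a + 2 * M) = 2 * (3 * b), 4 * a < n & n < 4 * b],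
        [/\ a + 3 * b < 2 * M, n = a + 3 * b + 2 * M, 4 * a < n & 4 * b < n] |
        [/\ a + 3 * b < 2 * M, n + 2 * a = 2 * (3 * b + 2 * M), n < 4 * a & 4 * b < n]]%N].
Proof.
move=> aM bM; have [s1|s1] := leqP (2 * M) (a + 3 * b).
- have [s2|s2] := ltnP (3 * b) (3 * a + 2 * M); last first.
    exists (2 * (3 * b - (a + 2 * M)))%N; split; try (by left; rewrite oddM); first lia.
    by constructor 2; split; lia.
  exists (a + 3 * b - 2 * M)%N; split; first lia; last by constructor 1; split; lia.
  + have [on|on] := boolP (odd (a + 3 * b - 2 * M)); [right|by left].
    (* An odd tick gives [a] and [b] different parities; their order tells which distance wraps
       around. *)
    have [ab|ab] := leqP a b.
      have [q qE] : exists q, (2 * j = b - a + 1 + 2 * q)%N.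
        by exists (2 * j - (b - a + 1))./2%N; lia.
      by exists q; rewrite /offset; [lia|constructor 2; lia].
    have [q qE] : exists q, (2 * j = a - b + 1 + 2 * q)%N.
      by exists (2 * j - (a - b + 1))./2%N; lia.
    by exists q; rewrite /offset; [lia|constructor 3; lia].
  + have [on|on] := boolP (odd (a + 3 * b - 2 * M)); [right|by left].
    have [ab|ab] := leqP a b.
      have [q qE] : exists q, (2 * j = b - a + 1 + 2 * q)%N.
        by exists (2 * j - (b - a + 1))./2%N; lia.
      by exists q; rewrite /offset; [lia|constructor 3; lia].
    have [q qE] : exists q, (2 * j = a - b + 1 + 2 * q)%N.
      by exists (2 * j - (a - b + 1))./2%N; lia.
    by exists q; rewrite /offset; [lia|constructor 2; lia].
- have [s2|s2] := ltnP (3 * a) (3 * b + 2 * M); last first.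
    exists (2 * (3 * b + 2 * M - a))%N; split; try (by left; rewrite oddM); first lia.
    by constructor 4; split; lia.
  exists (a + 3 * b + 2 * M)%N; split; first lia; last by constructor 3; split; lia.
  + have [on|on] := boolP (odd (a + 3 * b + 2 * M)); [right|by left].
    have [ab|ab] := leqP a b.
      have [q qE] : exists q, (2 * j = b - a + 1 + 2 * q)%N.
        by exists (2 * j - (b - a + 1))./2%N; lia.
      by exists q; rewrite /offset; [lia|constructor 4; lia].
    have [q qE] : exists q, (2 * j = a - b + 1 + 2 * q)%N.
      by exists (2 * j - (a - b + 1))./2%N; lia.
    by exists q; rewrite /offset; [lia|constructor 1; lia].
  + have [on|on] := boolP (odd (a + 3 * b + 2 * M)); [right|by left].
    have [ab|ab] := leqP a b.
      have [q qE] : exists q, (2 * j = b - a + 1 + 2 * q)%N.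
        by exists (2 * j - (b - a + 1))./2%N; lia.
      by exists q; rewrite /offset; [lia|constructor 1; lia].
    have [q qE] : exists q, (2 * j = a - b + 1 + 2 * q)%N.
      by exists (2 * j - (a - b + 1))./2%N; lia.
    by exists q; rewrite /offset; [lia|constructor 4; lia].
Qed.

Lemma meet13 (e1 e2 : bool) (a b : nat) : (a < M)%N -> (b < M)%N ->
  exists n, [/\ meet_at M (sg e1) a (sg e2 * 3) b n,
                on_time false a n & on_time true b n].
Proof.
move=> aM bM; case e12 : (e1 (+) e2).
- have [n [nM on1 on2 C]] := time_opp aM bM.
  by exists n; split => //; exact: meet13_opp.
- have [n [nM on1 on2 C]] := time_same aM bM.
  by exists n; split => //; exact: meet13_same.
Qed.

End UnequalSides.

(** * The arrangement *)

Section Arrangement.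
Context {R : realType} (j : nat).
Local Notation M := (3 * j + 1)%N.
Local Notation tick := (@tick R M).
Local Notation sg := (@sg R).
Local Notation side := (@side R M).

Definition slope (c : bool * bool) : R := sg c.2 * (if c.1 then 3 else 1).

(** [None] is the line z = 0; with 2 M fibers and 4 M sides this makes 6 M + 1 = 18 j + 7. *)
Definition line_index : finType :=
  option ('I_(2 * M) + (bool * bool) * 'I_M)%type.

Definition curve (i : line_index) : set (RP2 R) :=
  match i with
  | None => graph_curve M%:R (side 0 0)
  | Some (inl k) => fiber_curve M%:R (tick (2 * k))
  | Some (inr (c, a)) => graph_curve M%:R (side (slope c) a)
  end.

(** Lists the ticks of [on_time], reduced modulo 4 M, from a type with 2 M + 2 j elements. *)
Definition side_time (b3 : bool) (a : nat) (t : 'I_(2 * M) + bool * 'I_j) : nat :=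
  (match t with
  | inl k => 2 * k
  | inr (false, k) => if 4 * a + offset j b3 k < 4 * M then 4 * a + offset j b3 k
                      else 4 * a + offset j b3 k - 4 * M
  | inr (true, k) => if offset j b3 k <= 4 * a then 4 * a - offset j b3 k
                     else 4 * a + 4 * M - offset j b3 k
  end)%N.

(* The nonzero heights on a fiber are +-y and +-3 y, where [0 < y <= M] has the
   parity of [M + k]. *)
Definition fiber_height (k : nat) (t : option ((bool * bool) * 'I_(2 * j))) : R :=
  if t is Some (c, q) then slope c * (2 * q + 1 + ~~ odd (M + k))%N%:R else 0.

(** Sets containing the vertices on each curve, given as ranges of finite types so that counting
    indices bounds them: 2 M on z = 0, 2 + 8 j on a fiber, 2 M + 2 j on a side. *)
Definition vertex_set (i : line_index) : set (RP2 R) :=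
  match i with
  | None => range (fun k : 'I_(2 * M) => pt (mob M%:R (tick (2 * k), 0)))
  | Some (inl k) => range (fun t : option (option ((bool * bool) * 'I_(2 * j))) =>
      if t is Some h then pt (mob M%:R (tick (2 * k), fiber_height k h))
      else pole_point)
  | Some (inr (c, a)) => range (fun t : 'I_(2 * M) + bool * 'I_j =>
      let x := tick (side_time c.1 a t) in pt (mob M%:R (x, side (slope c) a x)))
  end.

Lemma range_card_le (T : finType) (U : Type) (f : T -> U) : range f #<= `I_#|T|.
Proof.
apply: card_le_trans (card_image_le _ _) _.
apply: (@card_le_trans _ _ _ [set: 'I_#|T|]); last first.
  by have := @card_II #|T|; rewrite card_eq_le => /andP[].
apply: card_le_trans (card_image_le (@enum_val T predT) [set: 'I_#|T|]).
apply: subset_card_le => x _; exists (enum_rank x) => //.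
exact: enum_rankK.
Qed.

Lemma line_index_card : [set: line_index] #= `I_(18 * j + 7).
Proof.
have -> : (18 * j + 7 = #|line_index|)%N.
  rewrite card_option card_sum !card_prod card_bool !card_ord; lia.
rewrite card_eq_le; apply/andP; split; last first.
  have : `I_#|line_index| #<= [set: 'I_#|line_index|].
    by have := @card_II #|line_index|; rewrite card_eq_le => /andP[].
  move=> /card_le_trans; apply.
  apply: card_le_trans (card_image_le (@enum_rank line_index) setT).
  apply: subset_card_le => x _; exists (enum_val x) => //.
  exact: enum_valK.
have := @range_card_le line_index _ id; congr (_ #<= _).
by rewrite image_id.
Qed.

Lemma M_gt0 : 0 < M%:R :> R.
Proof. by rewrite ltr0n; lia. Qed.

Lemma slope_neq0 c : slope c != 0.
Proof. by rewrite mulf_neq0 ?sg_neq0//; case: c.1; rewrite ?oner_neq0 ?pnatr_eq0. Qed.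

Lemma side_timeP (b3 : bool) (a n : nat) : (n < 4 * M)%N -> on_time j b3 a n ->
  exists t, n = side_time b3 a t.
Proof.
move=> nM [on|[k kj nE]].
  have n2 : (n./2 < 2 * M)%N by lia.
  by exists (inl (Ordinal n2)); rewrite /=; lia.
case: nE => nE.
- by exists (inr (false, Ordinal kj)); rewrite /= -nE nM.
- by exists (inr (true, Ordinal kj)); rewrite /= -nE leq_addl addnK.
- exists (inr (false, Ordinal kj)); rewrite /= -nE addnK.
  by rewrite ltnNge leq_addl.
- by exists (inr (true, Ordinal kj)); rewrite /= -nE addnK ifN; lia.
Qed.

Lemma vertex_set_side c (a : 'I_M) (n : nat) :
  (n < 4 * M)%N -> on_time j c.1 a n ->
  vertex_set (Some (inr (c, a))) (pt (mob M%:R (tick n, side (slope c) a (tick n)))).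
Proof. by move=> nM /(side_timeP nM)[t ->]; exists t. Qed.

Lemma side0E a x : side 0 a x = 0.
Proof. by rewrite /side mul0r. Qed.

Lemma side0 a : side 0 a = side 0 0.
Proof. by apply/funext => x; rewrite !side0E. Qed.

Lemma vertex_set_infinity (n : nat) : (n < 4 * M)%N -> ~~ odd n ->
  vertex_set None (pt (mob M%:R (tick n, 0))).
Proof.
move=> nM on; have n2 : (n./2 < 2 * M)%N by lia.
exists (Ordinal n2); first by [].
by rewrite (_ : 2 * Ordinal n2 = n)%N//=; lia.
Qed.

Lemma fiber_tick_lt (k : 'I_(2 * M)) : `|tick (2 * k)| < M%:R.
Proof. by apply: tick_lt; have := ltn_ord k; lia. Qed.

(** Bundles what the arrangement needs with what the vertex count needs. *)
Definition curves_meet (i k : line_index) : Prop :=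
  exists p, [/\ curve i `&` curve k = [set p], cross_at R (curve i) (curve k) p,
                vertex_set i p & vertex_set k p].

Lemma curves_meet_sym i k : curves_meet i k -> curves_meet k i.
Proof.
by move=> [p [I C vi vk]]; exists p; split; rewrite 1?setIC//; exact: cross_at_sym.
Qed.

Lemma sides_meet c c' (a a' : 'I_M) n :
  meet_at M (slope c) a (slope c') a' n ->
  on_time j c.1 a n -> on_time j c'.1 a' n ->
  curves_meet (Some (inr (c, a))) (Some (inr (c', a'))).
Proof.
move=> [nM eqT I C] on on'.
exists (pt (mob M%:R (tick n, side (slope c) a (tick n)))); split => //.
  exact: vertex_set_side.
by rewrite eqT; exact: vertex_set_side.
Qed.

Lemma side_side_meet c c' (a a' : 'I_M) : (c, a) != (c', a') ->
  curves_meet (Some (inr (c, a))) (Some (inr (c', a'))).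
Proof.
have aM := ltn_ord a; have aM' := ltn_ord a'.
case: c c' => [b3 e] [b3' e'].
have [<-{b3'}|] := eqVneq b3 b3'; last first.
  (* Different classes: by symmetry the flat side may come first. *)
  have meet (f f' : bool) (b b' : 'I_M) :
      curves_meet (Some (inr ((false, f), b))) (Some (inr ((true, f'), b'))).
    have [n [mn on on']] := @meet13 R j f f' _ _ (ltn_ord b) (ltn_ord b').
    by apply: (@sides_meet (false, f) (true, f') _ _ n) => //; rewrite /slope /= mulr1.
  case: b3 b3' => [] [] bb _; try by rewrite eqxx in bb.
    exact: curves_meet_sym (meet e' e a' a).
  exact: (meet e e' a a').
have [<-{e'}|ee' _] := eqVneq e e'.
  rewrite !xpair_eqE !eqxx /= neq_ltn => /orP[a_lt|a_lt].
    apply: (sides_meet (c := (b3, e)) (c' := (b3, e))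
      (meet_same (slope_neq0 (b3, e)) a_lt aM')); by left; rewrite oddM.
  apply: curves_meet_sym.
  apply: (sides_meet (c := (b3, e)) (c' := (b3, e))
    (meet_same (slope_neq0 (b3, e)) a_lt aM)); by left; rewrite oddM.
have slopeN : slope (b3, e') = - slope (b3, e).
  by case: e e' ee' => [] [] // _; rewrite /slope /sg /= !(mulN1r, mul1r) ?opprK.
have [n on mn] := meet_opp (slope_neq0 (b3, e)) aM aM'.
by apply: (@sides_meet (b3, e) (b3, e') _ _ n); [rewrite slopeN|left|left].
Qed.

(** Injectivity separates the parameters 0 and 1/2. *)
Lemma simple_closed_curve_neq1 (C : set (RP2 R)) p :
  simple_closed_curve R C -> C <> [set p].
Proof.
move=> [c [_ _ cI ->]] cp; have c_p x : 0 <= x <= 1 -> c x = p.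
  move=> x01; have : (c @` `[0, 1]) (c x) by exists x => //=; rewrite in_itv.
  by rewrite cp.
have /eqP : 0 = 2^-1 :> R.
  by apply: cI; rewrite ?in_itv/= ?c_p//; lra.
by rewrite eq_sym invr_eq0 pnatr_eq0.
Qed.

Lemma curve_closed i : simple_closed_curve R (curve i).
Proof.
case: i => [[k|[c a]]|].
- exact (fiber_curve_closed M_gt0 (fiber_tick_lt k)).
- exact (graph_curve_closed M_gt0 (@side_continuous _ _ _ _) (side_seam _ (ltn_ord a))).
- have seam0 : side 0 0 M%:R = - side 0 0 (- M%:R) by rewrite !side0E oppr0.
  exact (graph_curve_closed M_gt0 (@side_continuous _ _ 0 0) seam0).
Qed.

Context (j_gt0 : (0 < j)%N).

Lemma vertex_set_card i : vertex_set i #<= `I_(8 * j + 2).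
Proof.
have le (m : nat) (A : set (RP2 R)) : A #<= `I_m -> (m <= 8 * j + 2)%N ->
    A #<= `I_(8 * j + 2).
  by move=> Am mj; apply: card_le_trans Am _; rewrite card_le_II.
case: i => [[k|[c a]]|]; apply: le; try exact: range_card_le.
- by rewrite !card_option !card_prod card_bool card_ord; lia.
- by rewrite card_sum card_prod card_bool !card_ord; lia.
- by rewrite card_ord; lia.
Qed.

(** Fiber and center are an integer |k - 2 a| apart, of the parity of [k], so M minus it is, up to
    sign, some y <= M with the parity of M + k. *)
Lemma vertex_set_fiber (k : 'I_(2 * M)) c (a : 'I_M) :
  vertex_set (Some (inl k))
    (pt (mob M%:R (tick (2 * k), side (slope c) a (tick (2 * k))))).
Proof.
have kM := ltn_ord k; have aM := ltn_ord a.
have [e [y [yM yodd yE]]] : exists (e : bool) (y : nat),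
    [/\ (y <= M)%N, odd y = odd (M + k) &
        M%:R - `|tick (2 * k) - tick (4 * a)| = sg e * y%:R].
  have dE : tick (2 * k) - tick (4 * a) = k%:R - 2 * a%:R.
    by rewrite /tick !natrM; lra.
  have [d [d2 dodd {}dE]] : exists d : nat, [/\ (d < 2 * M)%N, odd d = odd k &
      `|tick (2 * k) - tick (4 * a)| = d%:R].
    rewrite dE; have [ka|ka] := leqP (2 * a) k.
      exists (k - 2 * a)%N; split; try lia.
      by rewrite natrB// natrM ger0_norm// subr_ge0 -natrM ler_nat.
    exists (2 * a - k)%N; split; try lia.
    by rewrite natrB 1?ltnW// natrM distrC ger0_norm// subr_ge0 -natrM ler_nat ltnW.
  rewrite dE; have [dM|dM] := leqP d M.
    exists false, (M - d)%N; split; try lia.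
    by rewrite /sg mul1r natrB.
  exists true, (d - M)%N; split; try lia.
  by rewrite /sg mulN1r natrB ?opprB// ltnW.
rewrite /side yE; have [y0|y0] := posnP y.
  by exists (Some None) => //=; rewrite y0 !mulr0.
(* From y <= 3 j + 1 and j > 0; y is 2 q + 1 or 2 q + 2 with this half as q. *)
have qj : (y.-1./2 < 2 * j)%N by lia.
exists (Some (Some ((c.1, c.2 (+) e), Ordinal qj))) => //=.
congr (pt (mob _ (_, _))); rewrite /slope /=.
have -> : (2 * y.-1./2 + 1 + ~~ odd (M + k))%N = y by rewrite -yodd; lia.
by case: (c.2); case: e {yE}; rewrite /sg /=; lra.
Qed.

Lemma distinct_curves_meet i k : i != k -> curves_meet i k.
Proof.
have seam0 : side 0 0 M%:R = - side 0 0 (- M%:R) by rewrite !side0E oppr0.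
have fiber_infinity t : curves_meet None (Some (inl t)).
  have [I C] := graph_fiber_cross M_gt0 (@side_continuous _ _ 0 0) seam0 (fiber_tick_lt t).
  exists (pt (mob M%:R (tick (2 * t), side 0 0 (tick (2 * t))))); split => //.
    by rewrite side0E; apply: vertex_set_infinity; [have := ltn_ord t; lia|rewrite oddM].
  by exists (Some None) => //=; rewrite side0E.
have side_infinity c (a : 'I_M) : curves_meet None (Some (inr (c, a))).
  have [n on [nM eqT I C]] := meet_zero (slope_neq0 c) (ltn_ord a).
  rewrite (side0 a) in eqT I C.
  exists (pt (mob M%:R (tick n, side 0 0 (tick n)))); split => //.
    by rewrite side0E; exact: vertex_set_infinity.
  by rewrite eqT; apply: vertex_set_side => //; left.
have fiber_side t c (a : 'I_M) : curves_meet (Some (inr (c, a))) (Some (inl t)).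
  have [I C] := graph_fiber_cross M_gt0 (@side_continuous _ _ (slope c) a)
    (side_seam _ (ltn_ord a)) (fiber_tick_lt t).
  exists (pt (mob M%:R (tick (2 * t), side (slope c) a (tick (2 * t))))); split => //.
    by apply: vertex_set_side; [have := ltn_ord t; lia|left; rewrite oddM].
  exact: vertex_set_fiber.
case: i k => [[t|[c a]]|] [[t'|[c' a']]|] // ik.
- have [|I C] := fiber_fiber_cross M_gt0 (fiber_tick_lt t) (fiber_tick_lt t').
    apply: contra_neq ik; rewrite /tick !natrM => tt'.
    suff /eqP : t%:R = t'%:R :> R by rewrite eqr_nat => /eqP/val_inj ->.
    by lra.
  by exists pole_point; split => //; exists None.
- exact/curves_meet_sym/fiber_side.
- exact/curves_meet_sym/fiber_infinity.
- by apply: side_side_meet; apply: contra_neq ik => -[-> ->].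
- exact/curves_meet_sym/side_infinity.
Qed.

(** Two indices with the same curve would make it equal to its one-point intersection with
    itself. *)
Lemma curve_inj : injective curve.
Proof.
move=> i k ik; apply/eqP; apply: contraT => /distinct_curves_meet[p [I _ _ _]].
by case: (@simple_closed_curve_neq1 _ p (curve_closed i)); rewrite -I ik setIid.
Qed.

End Arrangement.

Theorem theorem3 (R : realType) (j : nat) (j_gt0 : (0 < j)%N) :
  exists L : set (set (RP2 R)),
    [/\ pseudoline_arrangement L,
        L #= `I_(18 * j + 7)%N,
        ~ (exists p, forall C, L C -> C p) &
        forall C, L C -> C `&` vertices L #<= `I_(8 * j + 2)%N].
Proof.
exists (range (@curve R j)); split.
- split.
  + by apply: finite_image; exact: finite_finset.
  + by move=> _ [i _ <-]; exact: curve_closed.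
  + move=> _ _ [i _ <-] [k _ <-] ik.
    have ik' : i != k by apply/eqP => eqik; apply: ik; rewrite eqik.
    have [p [I C _ _]] := @distinct_curves_meet R j j_gt0 i k ik'.
    by exists p.
- apply: card_eq_trans (line_index_card j); apply: inj_card_eq.
  by move=> x y _ _; exact: (@curve_inj R j j_gt0).
(* Two fibers share only the pole, and z = 0 avoids it. *)
- move=> [p pL].
  have seam0 : side (3 * j + 1) 0 0 (3 * j + 1)%:R =
      - side (3 * j + 1) 0 0 (- (3 * j + 1)%:R) :> R by rewrite !side0E oppr0.
  have M2 : (1 < 2 * (3 * j + 1))%N by lia.
  have p0 := pL _ (imageT (@curve R j) (Some (inl (Ordinal (ltnW M2))))).
  have p1 := pL _ (imageT (@curve R j) (Some (inl (Ordinal M2)))).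
  have /(graph_curveE (M_gt0 j) _ seam0).1 [s sI pE] :=
    pL _ (imageT (@curve R j) None).
  have [|I _] := @fiber_fiber_cross R _ (M_gt0 j) _ _
    (fiber_tick_lt (Ordinal (ltnW M2))) (fiber_tick_lt (Ordinal M2)).
    by rewrite /= /tick; lra.
  have pP : p = pole_point by have : [set pole_point] p by rewrite -I.
  apply: (@mob_neq_pole R _ (M_gt0 j) (s, side (3 * j + 1) 0 0 s)).
    by case/andP: sI => ? /ltW ?; rewrite ler_norml; apply/andP.
  by rewrite -pE.
- move=> _ [i _ <-]; apply: card_le_trans (vertex_set_card j_gt0 i).
  apply: subset_card_le => p [ip [_ [_ [[k1 _ <-] [k2 _ <-] k12 k1p k2p]]]].
  (* Of the two distinct curves through the vertex, at least one is not [curve i]; its only common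
     point with [curve i] is in [vertex_set i]. *)
  have [k ik kp] : exists2 k, i != k & curve k p.
    have [ik1|] := eqVneq i k1; last by exists k1.
    by exists k2 => //; apply/eqP => ik2; apply: k12; rewrite -ik1 ik2.
  have [q [I _ iq _]] := @distinct_curves_meet R j j_gt0 i k ik.
  by have : (curve i `&` curve k) p by []; rewrite I => ->.
Qed.
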